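(* Let $G$ be a finite simple graph and let $u,v,w,z$ be vertices such that the pivot sequence $[uv][wz]$ is applicable to $G$. Write $(p_1,p_2,p_3,p_4)=(u,v,w,z)$. Then for all vertices $x,y$ of $G$, $$x\sim_{G[uv][wz]}y \;=\; (x\sim_G y)\;\oplus\bigoplus_{\substack{\{i,j\}\subseteq\{1,2,3,4\},\ i\neq j\\ p_i\sim_G p_j}}\Big(\big((x\sim_G p_k)\wedge(y\sim_G p_l)\big)\oplus\big((x\sim_G p_l)\wedge(y\sim_G p_k)\big)\Big),$$ where for each 2-element set $\{i,j\}$, $\{k,l\}=\{1,2,3,4\}\setminus\{i,j\}$.
   Context: $x\sim_H y$ holds iff $\{x,y\}\in E(H)$ or $x=y$; statements are Boolean-valued and $\oplus$ is exclusive or. Pivot: for an edge $\{a,b\}$, with $N'(x)=N(x)\cup\{x\}$, $V_1=N'(a)\setminus N'(b)$, $V_2=N'(b)\setminus N'(a)$, $V_3=N'(a)\cap N'(b)$, the graph $G[ab]$ is obtained by toggling every pair $\{x,y\}$ with $x\in V_i$, $y\in V_j$, $i\neq j$. The sequence $[uv][wz]$ is applicable to $G$ if $\{u,v\}\in E(G)$ and $\{w,z\}\in E(G[uv])$; $G[uv][wz]$ is the resulting graph. *)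

(* Defs.v *)
From mathcomp Require Import all_boot.

Set Implicit Arguments.
Unset Strict Implicit.
Unset Printing Implicit Defensive.

Record sgraph (T : finType) := SGraph {
  edge : rel T;
  edge_sym : symmetric edge;
  edge_irr : irreflexive edge
}.

Section Pivot.
Variables (T : finType) (G : sgraph T).

Definition sim (x y : T) : bool := edge G x y || (x == y).

Definition nbh (x : T) : {set T} := [set y | edge G x y].

Definition cnbh (x : T) : {set T} := nbh x :|: [set x].

Variables a b : T.

(* The classes V_1, V_2, V_3 are the values at 0, 1, 2. *)
Definition pivot_class (i : 'I_3) : {set T} :=
  tnth [tuple cnbh a :\: cnbh b; cnbh b :\: cnbh a; cnbh a :&: cnbh b] i.

Definition pivot_toggled (x y : T) : bool :=
  [exists i : 'I_3, exists j : 'I_3,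
     [&& i != j, x \in pivot_class i & y \in pivot_class j]].

Definition pivot_edge (x y : T) : bool := edge G x y (+) pivot_toggled x y.

Fact pivot_class_inj (x : T) (i j : 'I_3) :
  x \in pivot_class i -> x \in pivot_class j -> i = j.
Proof.
case: i => [[|[|[|//]]] ?]; case: j => [[|[|[|//]]] ?];
  rewrite /pivot_class !(tnth_nth set0) /= !(in_setD, in_setI);
  by case: (x \in cnbh a); case: (x \in cnbh b) => // *; apply: val_inj.
Qed.

Fact pivot_edge_sym : symmetric pivot_edge.
Proof.
suff tog x y : pivot_toggled x y -> pivot_toggled y x.
  by move=> x y; rewrite /pivot_edge edge_sym; congr (_ (+) _); apply/idP/idP; apply: tog.
case/existsP=> i /existsP [j /and3P [ne xi yj]].
by apply/existsP; exists j; apply/existsP; exists i; rewrite eq_sym ne yj.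
Qed.

Fact pivot_edge_irr : irreflexive pivot_edge.
Proof.
move=> x; rewrite /pivot_edge edge_irr /=; apply/negbTE/negP.
case/existsP=> i /existsP [j /and3P [/eqP ne xi xj]].
exact: ne (pivot_class_inj xi xj).
Qed.

(* G[ab]; defined for all a and b, but meaningful only when {a, b} is an edge. *)
Definition pivot : sgraph T := SGraph pivot_edge_sym pivot_edge_irr.

End Pivot.

Definition applicable (T : finType) (G : sgraph T) (u v w z : T) : bool :=
  edge G u v && edge (pivot G u v) w z.

(* Main.v *)
(* Over GF(2), pivoting on {a, b} adds to the matrix of the relation [sim] the
   symmetrised product of its columns a and b, i.e. the determinant of the
   submatrix with rows x, y and columns a, b.  Applying this twice and expanding,
   the products of x- and y-columns combine into the claimed sum once
   sim u v = 1 and sim w z + sim w u sim z v + sim w v sim z u = 1 are used,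
   which is exactly the applicability of the sequence. *)
Require Import Defs.
From mathcomp Require Import all_boot.

Lemma sim_sym (T : finType) (G : sgraph T) : symmetric (sim G).
Proof. by move=> x y; rewrite /sim edge_sym eq_sym. Qed.

Lemma in_cnbh (T : finType) (G : sgraph T) (a x : T) :
  (x \in cnbh G a) = sim G x a.
Proof. by rewrite /cnbh in_setU in_set1 in_set edge_sym. Qed.

(** The three classes are the three nonzero vectors ([sim x a], [sim x b]) of GF(2)^2, and two
    vectors have determinant 1 exactly when they are nonzero and distinct. *)
Lemma pivot_toggledE (T : finType) (G : sgraph T) (a b x y : T) :
  pivot_toggled G a b x y =
  (sim G x a && sim G y b) (+) (sim G x b && sim G y a).
Proof.
have cls i z : z \in pivot_class G a b i =
    nth false [:: sim G z a && ~~ sim G z b; sim G z b && ~~ sim G z a;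
                  sim G z a && sim G z b] i.
  case: i => [[|[|[|//]]] ?]; rewrite /pivot_class (tnth_nth set0) /=;
    by rewrite !(in_setD, in_setI) !in_cnbh // andbC.
apply/existsP/idP => [[i /existsP [j]]|].
  rewrite !cls; case: i j => [[|[|[|//]]] ?] [[|[|[|//]]] ?] //=;
  by case: (sim G x a) (sim G x b) (sim G y a) (sim G y b) => [] [] [] [].
have witness (i j : 'I_3) : [&& i != j, x \in pivot_class G a b i
    & y \in pivot_class G a b j] -> exists i, [exists j, [&& i != j,
    x \in pivot_class G a b i & y \in pivot_class G a b j]].
  by move=> ij; exists i; apply/existsP; exists j.
(* The class of each vector; the value 0 at (0,0) is junk, excluded by [xy]. *)
pose c s t : 'I_3 := inord (if s && t then 2 else t).
move=> xy; apply: (witness (c (sim G x a) (sim G x b))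
                           (c (sim G y a) (sim G y b))).
rewrite !cls -val_eqE /= /c; move: xy.
by case: (sim G x a) (sim G x b) (sim G y a) (sim G y b) => [] [] [] [] //=;
  rewrite !inordK.
Qed.

Lemma sim_pivot (T : finType) (G : sgraph T) (a b x y : T) :
  sim (pivot G a b) x y =
  sim G x y (+) ((sim G x a && sim G y b) (+) (sim G x b && sim G y a)).
Proof.
rewrite -pivot_toggledE {1 2}/sim /=.
have [<-|_] := eqVneq x y; last by rewrite !orbF.
by have := edge_irr (pivot G a b) x; rewrite /= /pivot_edge edge_irr => /= ->.
Qed.

Lemma big_addb_ord4 (F : 'I_4 -> bool) :
  \big[addb/false]_(i < 4) F i =
  F (@Ordinal 4 0 isT) (+) F (@Ordinal 4 1 isT) (+)
  F (@Ordinal 4 2 isT) (+) F (@Ordinal 4 3 isT).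
Proof.
rewrite !big_ord_recr big_ord0 /=.
by congr (F _ (+) F _ (+) F _ (+) F _); apply: val_inj.
Qed.

(** Makes the complement condition computable by [/=] at concrete indices. *)
Lemma set2_eqC_ord4 (i j k l : 'I_4) :
  ([set k; l] == ~: [set i; j]) =
  all (fun m : nat => ((m == k) || (m == l)) == ~~ ((m == i) || (m == j)))
      (iota 0 4).
Proof.
apply/eqP/allP => [/setP E m|E].
  rewrite mem_iota => /= m4; have := E (Ordinal m4).
  by rewrite !inE -!val_eqE /= => ->.
apply/setP=> m; rewrite !inE -!val_eqE /=; apply/eqP/E.
by rewrite mem_iota /=.
Qed.

(* Two-element subsets of the index set 'I_4 are represented by pairs i < j;
   the inner sum ranges over the single pair k < l with {k, l} the complement
   of {i, j}. *)
Theorem theorem11 (T : finType) (G : sgraph T) (u v w z : T)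
    (Happ : applicable G u v w z) (x y : T) :
  let p := tnth [tuple u; v; w; z] in
  sim (pivot (pivot G u v) w z) x y =
  sim G x y (+)
    \big[addb/false]_(i < 4) \big[addb/false]_(j < 4 | (i < j) && sim G (p i) (p j))
      \big[addb/false]_(k < 4)
        \big[addb/false]_(l < 4 | (k < l) && ([set k; l] == ~: [set i; j]))
          ((sim G x (p k) && sim G y (p l)) (+) (sim G x (p l) && sim G y (p k))).
Proof.
move=> p.
have [suv] : sim G u v /\ sim (pivot G u v) w z.
  by case/andP: Happ => uv wz; rewrite /sim uv wz.
have inner i j (F : 'I_4 -> 'I_4 -> bool) :
    \big[addb/false]_(k < 4)
      \big[addb/false]_(l < 4 | (k < l) && ([set k; l] == ~: [set i; j])) F k l =
    \big[addb/false]_(k < 4) \big[addb/false]_(l < 4)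
      if (k < l) && all (fun m : nat =>
        ((m == k) || (m == l)) == ~~ ((m == i) || (m == j))) (iota 0 4)
      then F k l else false.
  by apply: eq_bigr => k _; rewrite big_mkcond; apply: eq_bigr => l _;
    rewrite set2_eqC_ord4.
under eq_bigr => i _ do under eq_bigr => j _ do rewrite inner.
under eq_bigr => i _ do rewrite big_mkcond.
rewrite !big_addb_ord4 /= !(big_addb_ord4, addbF) /=.
rewrite /p !(tnth_nth u) /= !sim_pivot suv.
rewrite (sim_sym T G z u) (sim_sym T G z v) (sim_sym T G w u) (sim_sym T G w v).
move=> swz; rewrite -[LHS]addbA; congr (_ (+) _); move: swz.
(* Applicability determines [sim G w z] from the other four values, so half of the cases are
   vacuous. *)
case: (sim G u w) (sim G u z) (sim G v w) (sim G v z) (sim G w z)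
  => [] [] [] [] [] //= _;
case: (sim G x u) (sim G x v) (sim G x w) (sim G x z) => [] [] [] [];
by case: (sim G y u) (sim G y v) (sim G y w) (sim G y z) => [] [] [] [].
Qed.
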